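(* Consider the reduced Fokker-Planck model $$\partial_tF+v\cdot\nabla_xF=D_F(F,G),\qquad \partial_tG+v\cdot\nabla_xG=D_G(F,G),$$ with $$D_F(F,G)=\frac1\tau\nabla_v\cdot\bigl((v-u)F+RT\nabla_vF\bigr),$$ $$D_G(F,G)=\frac1\tau\nabla_v\cdot\bigl((v-u)G+RT\nabla_vG\bigr)+\frac2\tau\bigl(e_{int}(T)F-G\bigr),$$ where $\rho=\langle F\rangle_v$, $\rho u=\langle vF\rangle_v$, $\rho e=\langle\frac12|v-u|^2F\rangle_v+\langle G\rangle_v$, $T=\mathbb T(e)$. Then: 1. (Conservation) The collision operator conserves mass, momentum and energy: $$\langle D_F(F,G)\rangle_v=0,\quad\langle vD_F(F,G)\rangle_v=0,\quad \bigl\langle\tfrac12|v|^2D_F(F,G)+D_G(F,G)\bigr\rangle_v=0.$$ 2. (H-theorem) For every solution $(F,G)$ of the model, with $H(F,G)=F\log F-\frac FR s_{int}\!\left(\frac GF\right)$ and $\mathcal H(F,G)=\langle H(F,G)\rangle_v$, $$\partial_t\mathcal H(F,G)+\nabla_x\cdot\langle vH(F,G)\rangle_v\le0.$$ 3. (Equilibrium) $D_F(F,G)=0$ and $D_G(F,G)=0$ if and only if $F=M_{int}[F,G]$ and $G=e_{int}(T)M_{int}[F,G]$, where $$M_{int}[F,G](v)=\frac{\rho}{(2\pi RT)^{3/2}}\exp\Bigl(-\frac{|v-u|^2}{2RT}\Bigr).$$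
   Context: Thermodynamics: $R>0$ is a constant. $e_{int}:(0,\infty)\to\mathbb R$ is a $C^1$ function with $c_v^{int}(T)=e_{int}'(T)>0$; $J=e_{int}((0,\infty))$ and $\mathbb T_{int}:J\to(0,\infty)$ is the inverse of $e_{int}$. The total energy is $e(T)=\frac32RT+e_{int}(T)$, strictly increasing, with inverse function $\mathbb T$. $s_{int}:J\to\mathbb R$ is a fixed function with $s_{int}'(\varepsilon)=1/\mathbb T_{int}(\varepsilon)$. Notation: $t\ge0$, $x\in\mathbb R^3$, $v\in\mathbb R^3$; $\langle\psi\rangle_v=\int_{\mathbb R^3}\psi\,dv$. $\tau>0$ is a relaxation time (it may depend on $(t,x)$ through the macroscopic quantities). In items 1 and 3, $t,x$ are parameters and $F,G$ may be viewed as functions of $v$ only. Regularity convention: $F>0$, $G/F$ takes values in $J$; $F,G$ are smooth and decay fast enough in $v$ that all velocity integrals involved converge absolutely, derivatives in $t$ and $x$ may be exchanged with integration in $v$, and integrations by parts in $v$ produce no boundary terms at infinity (this applies to the fluxes $(v-u)F+RT\nabla_vF$ and $(v-u)G+RT\nabla_vG$ multiplied by $1$, $v$, $|v|^2$, $F/M_{int}$, $G/M_{int}$ or the partial derivatives of $H$ evaluated at $(F,G)$). *)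

(* Defs.v *)
From HB Require Import structures.
From mathcomp Require Import all_boot all_order all_algebra.
From mathcomp Require Import all_classical all_reals all_analysis.

Set Implicit Arguments.
Unset Strict Implicit.
Unset Printing Implicit Defensive.

Import Order.TTheory GRing.Theory Num.Theory.
Import numFieldNormedType.Exports.

Local Open Scope classical_set_scope.
Local Open Scope ring_scope.

Notation vec R := 'rV[R]_3.

(* The library norm on ['rV_3] is the sup norm, so the Euclidean structure is
   spelled out. *)
Definition dot (R : realType) (v w : vec R) : R := \sum_i v 0 i * w 0 i.
Definition sqn (R : realType) (v : vec R) : R := dot v v.

Definition basis (R : realType) (i : 'I_3) : vec R := delta_mx 0 i.

Definition grad (R : realType) (f : vec R -> R) (v : vec R) : vec R :=
  \row_i 'D_(basis R i) f v.

Definition div3 (R : realType) (Phi : vec R -> vec R) (v : vec R) : R :=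
  \sum_i 'D_(basis R i) (fun w => Phi w 0 i) v.

(* C^infinity: all iterated directional derivatives exist and are (Frechet)
   differentiable everywhere. *)
Definition smooth (R : realType) (V : normedModType R) (f : V -> R) : Prop :=
  forall (ds : seq V) (p : V),
    differentiable (foldr (fun (d : V) (g : V -> R) => fun q => 'D_d g q) f ds) p.

(* Derivative in time on the half-line [0, +oo[: two-sided for [t > 0],
   one-sided at [t = 0]. *)
Definition dt_quot (R : realType) (f : R -> R) (t : R) : set_system R :=
  (fun h => h^-1 * (f (t + h) - f t)) @
    within [set h : R | 0 <= t + h] (0 : R)^'.
Definition is_dt (R : realType) (f : R -> R) (t l : R) : Prop :=
  dt_quot f t --> l.
Definition dt (R : realType) (f : R -> R) (t : R) : R := lim (dt_quot f t).

(* Smoothness up to the boundary of a function of (t, x, v), t >= 0: it is the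
   restriction of a smooth function on the whole space. *)
Definition smooth_txv (R : realType) (F : R -> vec R -> vec R -> R) : Prop :=
  exists2 Ft : R * vec R * vec R -> R, smooth Ft &
    forall t x v, 0 <= t -> F t x v = Ft (t, x, v).

Definition vec3 (R : realType) (p : R * (R * R)) : vec R :=
  \row_(i < 3) [:: p.1; p.2.1; p.2.2]`_i.

(* The library does not infer sigma-finiteness of a product of two Lebesgue
   measures (an instance for subprobabilities takes precedence), hence [leb2]. *)
Definition leb2 (R : realType) := (@lebesgue_measure R \x @lebesgue_measure R)%E.

HB.instance Definition _ (R : realType) := Measure.on (@leb2 R).

Lemma leb2_sigma_finite (R : realType) : sigma_finite setT (@leb2 R).
Proof.
have /sigma_finiteP[F [TF ndF Foo]] := sigma_finiteT (@lebesgue_measure R).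
exists (fun n => F n `*` F n).
  rewrite -setXTT {1}TF {1}TF predeqE => -[x y]; split.
    move=> [/= [n _ Fnx] [k _ Gky]]; exists (maxn n k) => //; split.
    - by move: x Fnx; exact/subsetPset/ndF/leq_maxl.
    - by move: y Gky; exact/subsetPset/ndF/leq_maxr.
  by move=> [n _ []/= ? ?]; split; exists n.
move=> k; have [? ?] := Foo k.
split; first exact: measurableX.
by rewrite /leb2 product_measure1E// lte_mul_pinfty// ge0_fin_numE.
Qed.

HB.instance Definition _ (R : realType) :=
  Measure_isSigmaFinite.Build _ _ _ (@leb2 R) (@leb2_sigma_finite R).

Definition leb3 (R : realType) := (@lebesgue_measure R \x @leb2 R)%E.

HB.instance Definition _ (R : realType) := Measure.on (@leb3 R).

Definition vintegrable (R : realType) (f : vec R -> R) : Prop :=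
  (@leb3 R).-integrable setT (fun p : R * (R * R) => (f (vec3 p))%:E).

Definition vint (R : realType) (f : vec R -> R) : R :=
  Rintegral (@leb3 R) setT (fun p : R * (R * R) => f (vec3 p)).

(* Integration by parts of [phi * div Phi] in v: both integrals converge
   absolutely and there is no boundary term at infinity. *)
Definition ibp (R : realType) (phi : vec R -> R) (Phi : vec R -> vec R) : Prop :=
  [/\ vintegrable (fun v => phi v * div3 Phi v),
      vintegrable (fun v => dot (grad phi v) (Phi v)) &
      vint (fun v => phi v * div3 Phi v) =
        - vint (fun v => dot (grad phi v) (Phi v))].

(* Functions of the temperature are total functions on [R], constrained only on
   the positive half-line; [Tint] and [Ttot] are thereby determined only on the
   ranges of [eint] and of the total energy, and [sint] only on that of [eint]. *)
Record gas (R : realType) := Gas {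
  gasR : R;
  eint : R -> R;
  Tint : R -> R;
  sint : R -> R;
  Ttot : R -> R;
  gasR_gt0 : 0 < gasR;
  eint_derivable : forall T : R, 0 < T -> derivable eint T 1;
  eint_C1 : forall T : R, 0 < T -> {for T, continuous (derive1 eint)};
  cv_gt0 : forall T : R, 0 < T -> 0 < derive1 eint T;
  TintK : forall T : R, 0 < T -> Tint (eint T) = T;
  sint_derive : forall T : R, 0 < T -> is_derive (eint T) 1 sint (Tint (eint T))^-1;
  TtotK : forall T : R, 0 < T -> Ttot (3 / 2 * gasR * T + eint T) = T
}.

Definition Jint (R : realType) (g : gas R) : set R :=
  eint g @` [set T | 0 < T].

Section Model.
Context (R : realType) (g : gas R).
Implicit Types F G : vec R -> R.

Definition rho F : R := vint F.
Definition bulk F : vec R := \row_i ((rho F)^-1 * vint (fun v => v 0 i * F v)).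
Definition energy F G : R :=
  (rho F)^-1 * (vint (fun v => 2^-1 * sqn (v - bulk F) * F v) + vint G).
Definition temp F G : R := Ttot g (energy F G).

(* Drift-diffusion flux [(v - u) f + R T grad f], for f = F or f = G; u and T
   are always those of the pair (F, G). *)
Definition flux F G (f : vec R -> R) (v : vec R) : vec R :=
  f v *: (v - bulk F) + (gasR g * temp F G) *: grad f v.

Definition collF (tau : R) F G (v : vec R) : R :=
  tau^-1 * div3 (flux F G F) v.

Definition collG (tau : R) F G (v : vec R) : R :=
  tau^-1 * div3 (flux F G G) v
    + 2 / tau * (eint g (temp F G) * F v - G v).

Definition maxwellian F G (v : vec R) : R :=
  rho F / (2 * pi * gasR g * temp F G) `^ (3 / 2)
    * expR (- (sqn (v - bulk F) / (2 * gasR g * temp F G))).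

Definition Hent (a b : R) : R := a * ln a - a / gasR g * sint g (b / a).
Definition dHentF (a b : R) : R := derive1 (fun a' => Hent a' b) a.
Definition dHentG (a b : R) : R := derive1 (fun b' => Hent a b') b.

Definition poly_weights : set (vec R -> R) :=
  [set phi : vec R -> R | [\/ phi = (fun=> 1), exists i, phi = (fun v => v 0 i)
               | phi = (fun v => sqn v)]].
Definition entropy_weights F G : set (vec R -> R) :=
  [set phi : vec R -> R | phi = (fun v => dHentF (F v) (G v))
          \/ phi = (fun v => dHentG (F v) (G v))].
Definition maxwellian_weights F G : set (vec R -> R) :=
  [set phi : vec R -> R | phi = (fun v => F v / maxwellian F G v)
          \/ phi = (fun v => G v / maxwellian F G v)].

Definition flux_ibp F G (weights : set (vec R -> R)) : Prop :=
  forall phi, weights phi ->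
    ibp phi (flux F G F) /\ ibp phi (flux F G G).

(* The last two fields integrate by parts the diffusion term [grad F] against
   [1] and [v_j]: the integral of [v_j d_i F] is [- delta_ij rho]. *)
Record velocity_regular F G : Prop := VelocityRegular {
  vreg_smoothF : smooth F;
  vreg_smoothG : smooth G;
  vreg_posF : forall v, 0 < F v;
  vreg_J : forall v, Jint g (G v / F v);
  vreg_mass : vintegrable F;
  vreg_momentum : forall i, vintegrable (fun v => v 0 i * F v);
  vreg_energyF : vintegrable (fun v => sqn v * F v);
  vreg_energyG : vintegrable G;
  vreg_flux : flux_ibp F G poly_weights;
  vreg_grad1 : forall i, ibp (fun=> 1) (fun v => F v *: basis R i);
  vreg_gradv : forall i j, ibp (fun v => v 0 j) (fun v => F v *: basis R i)
}.

Implicit Types f h : R -> vec R -> vec R -> R.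

Definition transport f (t : R) (x v : vec R) : R :=
  dt (fun s => f s x v) t + dot v (grad (fun y => f t y v) x).

Record solution (tau : R -> vec R -> R) f h : Prop := Solution {
  sol_smoothF : smooth_txv f;
  sol_smoothG : smooth_txv h;
  sol_regular : forall t x, 0 <= t -> velocity_regular (f t x) (h t x);
  sol_F : forall t x v, 0 <= t ->
    transport f t x v = collF (tau t x) (f t x) (h t x) v;
  sol_G : forall t x v, 0 <= t ->
    transport h t x v = collG (tau t x) (f t x) (h t x) v
}.

Definition Hdens f h (t : R) (x v : vec R) : R := Hent (f t x v) (h t x v).

Definition entropy f h (t : R) (x : vec R) : R := vint (Hdens f h t x).
Definition entropy_flux f h (t : R) (x : vec R) : vec R :=
  \row_i vint (fun v => v 0 i * Hdens f h t x v).

(* Absolute convergence of the integrals in the entropy balance, integration by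
   parts against the partial derivatives of H, and exchange of d_t and d_(x_i)
   with the integrals of H and v_i H. *)
Record entropy_regular f h : Prop := EntropyRegular {
  ereg_flux : forall t x, 0 <= t ->
    flux_ibp (f t x) (h t x) (entropy_weights (f t x) (h t x));
  ereg_H : forall t x, 0 <= t -> vintegrable (Hdens f h t x);
  ereg_vH : forall t x i, 0 <= t ->
    vintegrable (fun v => v 0 i * Hdens f h t x v);
  ereg_dtH : forall t x, 0 <= t ->
    vintegrable (fun v => dt (fun s => Hdens f h s x v) t);
  ereg_dt : forall t x, 0 <= t ->
    is_dt (fun s => entropy f h s x) t
          (vint (fun v => dt (fun s => Hdens f h s x v) t));
  ereg_dxH : forall t x i, 0 <= t ->
    vintegrable (fun v => v 0 i * 'D_(basis R i) (fun y => Hdens f h t y v) x);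
  ereg_dx : forall t x i, 0 <= t ->
    is_derive x (basis R i) (fun y => entropy_flux f h t y 0 i)
      (vint (fun v => v 0 i * 'D_(basis R i) (fun y => Hdens f h t y v) x))
}.

End Model.

(* Main.v *)
(* Since [G / F] takes values in the interval [J], so does its F-average, and the
   intermediate value theorem shows that the energy [e] is the total energy of a
   positive temperature [T]. This gives the balance
   [int (|v - u|^2 F + R T (v - u).grad F) = 2 int (eint(T) F - G)], from which
   conservation follows by integration by parts.

   For the H-theorem, let [theta = Tint (G / F)]. Integrating by parts, the terms
   in [(v - u)] and [grad theta] combine, up to squares with a good sign, into the
   left-hand side of this balance divided by [R T], while
   [(1 / T - 1 / theta) (eint T - eint theta) <= 0] lets one replace [1 / theta]
   by [1 / T] in the relaxation term; the two contributions then cancel.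

   At equilibrium, testing the equation of [F] against [F / M] gives
   [int R T M |grad (F / M)|^2 = 0], so [F] is a multiple of [M], and the Gaussian
   integral fixes the constant. Testing the equation of [G] against
   [G / M - eint T] gives
   [- int R T M |grad (G / M)|^2 = 2 int M (G / M - eint T)^2]. *)

Require Import Defs.
From mathcomp Require Import all_boot all_order all_algebra.
From mathcomp Require Import all_classical all_reals all_analysis.
From mathcomp Require Import measurable_realfun ring lra.

Set Implicit Arguments.
Unset Strict Implicit.
Unset Printing Implicit Defensive.

Import Order.TTheory GRing.Theory Num.Theory.
Import numFieldNormedType.Exports.
(* Restores the [basis] of [Defs], shadowed by that of topology. *)
Import Defs.

Local Open Scope classical_set_scope.
Local Open Scope ring_scope.

(** * Linearity, positivity and Gaussian values of integrals over velocity space *)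

Section VelocityIntegral.
Context {R : realType}.
Implicit Types f h : vec R -> R.

Lemma vintegrableD f h : vintegrable f -> vintegrable h ->
  vintegrable (fun v => f v + h v).
Proof.
move=> fi hi; have := @integrableD _ _ _ (@leb3 R) _ measurableT _ _ fi hi.
by apply: eq_integrable => // p _; rewrite EFinD.
Qed.

Lemma vintegrableZl k f : vintegrable f -> vintegrable (fun v => k * f v).
Proof.
move=> fi; have := @integrableZl _ _ _ (@leb3 R) _ measurableT k _ fi.
by apply: eq_integrable => // p _; rewrite EFinM.
Qed.

Lemma vintegrableB f h : vintegrable f -> vintegrable h ->
  vintegrable (fun v => f v - h v).
Proof.
move=> fi /(vintegrableZl (-1))/(vintegrableD fi).
by under eq_fun do rewrite mulN1r.
Qed.

Lemma vintegrable_sum n (f : 'I_n -> vec R -> R) :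
  (forall i, vintegrable (f i)) -> vintegrable (fun v => \sum_i f i v).
Proof.
elim: n f => [f _|n ih f fi].
  under eq_fun do rewrite big_ord0.
  exact: integrable0.
under eq_fun do rewrite big_ord_recl.
by apply: vintegrableD => //; exact: ih.
Qed.

Lemma vintD f h : vintegrable f -> vintegrable h ->
  vint (fun v => f v + h v) = vint f + vint h.
Proof. by move=> fi hi; rewrite /vint RintegralD. Qed.

Lemma vintB f h : vintegrable f -> vintegrable h ->
  vint (fun v => f v - h v) = vint f - vint h.
Proof. by move=> fi hi; rewrite /vint RintegralB. Qed.

Lemma vintZl k f : vintegrable f -> vint (fun v => k * f v) = k * vint f.
Proof. by move=> fi; rewrite /vint RintegralZl. Qed.

Lemma vint_sum n (f : 'I_n -> vec R -> R) : (forall i, vintegrable (f i)) ->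
  vint (fun v => \sum_i f i v) = \sum_i vint (f i).
Proof.
elim: n f => [f _|n ih f fi].
  under eq_fun do rewrite big_ord0.
  by rewrite big_ord0 /vint Rintegral_cst// mul0r.
under eq_fun do rewrite big_ord_recl.
by rewrite big_ord_recl vintD ?ih//; exact: vintegrable_sum.
Qed.

(** Packages linearity for three known integrals; both energy conservation and the entropy
    production integrate a combination of two divergences or dissipations and a relaxation term. *)
Lemma vint_comb3 (k l m : R) f1 f2 f3 (y1 y2 y3 : R) :
  vintegrable f1 -> vintegrable f2 -> vintegrable f3 ->
  vint f1 = y1 -> vint f2 = y2 -> vint f3 = y3 ->
  vint (fun v => k * f1 v + (l * f2 v + m * f3 v)) = k * y1 + (l * y2 + m * y3).
Proof.
move=> i1 i2 i3 <- <- <-.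
have j2 := vintegrableZl l i2; have j3 := vintegrableZl m i3.
rewrite (vintD (vintegrableZl k i1) (vintegrableD j2 j3)) (vintD j2 j3).
by rewrite !vintZl.
Qed.

Lemma le_vint f h : vintegrable f -> vintegrable h ->
  (forall v, f v <= h v) -> vint f <= vint h.
Proof. by move=> fi hi fh; apply: le_Rintegral => // p _; exact: fh. Qed.

Lemma vint_ge0 f : (forall v, 0 <= f v) -> 0 <= vint f.
Proof. by move=> f0; apply: Rintegral_ge0 => p _; exact: f0. Qed.

Lemma vec3E (p : R * (R * R)) :
  [/\ vec3 p 0 0 = p.1, vec3 p 0 1 = p.2.1 & vec3 p 0 (inord 2) = p.2.2].
Proof. by rewrite !mxE /= inordK. Qed.

Lemma big_ord3 (M : nmodType) (F : 'I_3 -> M) :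
  \sum_i F i = F 0 + F 1 + F (inord 2).
Proof.
rewrite !big_ord_recr big_ord0 /= add0r.
congr (F _ + F _ + F _); apply/val_inj => //=.
by rewrite inordK.
Qed.

Lemma forall_ord3 (P : 'I_3 -> Prop) : P 0 -> P 1 -> P (inord 2) -> forall i, P i.
Proof.
move=> P0 P1 P2; case=> -[|[|[|//]]] i3.
- by rewrite (_ : Ordinal _ = 0)//; exact/val_inj.
- by rewrite (_ : Ordinal _ = 1)//; exact/val_inj.
- by rewrite (_ : Ordinal _ = inord 2)//; apply/val_inj; rewrite /= inordK.
Qed.

(** By continuity [f] exceeds [f v0 / 2] on a small cube around [v0], so its integral is at least
    this value times the volume of the cube. *)
Lemma vint_gt0 f : continuous f -> vintegrable f -> (forall v, 0 <= f v) ->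
  forall v0, 0 < f v0 -> 0 < vint f.
Proof.
move=> cf fi f0 v0 fv0.
have /nbhs_ballP[e /= e0 He] : \forall v \near v0, f v0 / 2 < f v.
  have : (f v0 / 2 < f v0)%R by rewrite ltr_pdivrMr// ltr_pMr// ltr1n.
  exact: (cvgr_gt _ (cf v0)).
(* The ball of the sup norm is a cube, hence a product of intervals whose measure is a product of
   lengths. *)
pose I i := `](v0 0 i - e), (v0 0 i + e)[%classic : set R.
pose B := I 0 `*` (I 1 `*` I (inord 2)).
have Ilen i : (lebesgue_measure (I i) = (2 * e)%:E)%E.
  rewrite lebesgue_measure_itv /= lte_fin ltrBlDr -addrA ltrDl addr_gt0// -EFinB.
  by congr (_%:E); ring.
have mI i : measurable (I i) by exact: measurable_itv.
have mB : measurable B by do 2?apply: measurableX.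
have lB : (@leb3 R B = ((2 * e) ^+ 3)%:E)%E.
  rewrite /leb3 product_measure1E; [|exact: mI|by apply: measurableX; exact: mI].
  rewrite /leb2 [X in (_ * X)%E]product_measure1E; [|exact: mI|exact: mI].
  by rewrite [LHS](_ : _ = (2 * e)%:E * ((2 * e)%:E * (2 * e)%:E))%E;
    [rewrite -!EFinM; congr (_%:E); ring|congr (_ * (_ * _))%E; exact: Ilen].
have fB p : B p -> f v0 / 2 <= f (vec3 p).
  move=> [/= p1 [p2 p3]]; apply/ltW/He; split=> // i j; rewrite (ord1 i).
  have [E1 E2 E3] := vec3E p.
  rewrite /ball /=; move: j; apply: forall_ord3; rewrite ?E1 ?E2 ?E3.
  + by move: p1; rewrite /I /= in_itv /= ltr_norml; lra.
  + by move: p2; rewrite /I /= in_itv /= ltr_norml; lra.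
  + by move: p3; rewrite /I /= in_itv /= ltr_norml; lra.
have fiB : (@leb3 R).-integrable B (EFin \o (fun p => f (vec3 p))).
  by apply: integrableS fi.
apply: (@lt_le_trans _ _ (f v0 / 2 * (2 * e) ^+ 3)).
  by rewrite mulr_gt0 ?divr_gt0// exprn_gt0// mulr_gt0.
rewrite -[(2 * e) ^+ 3]/(fine ((2 * e) ^+ 3)%:E) -lB -Rintegral_cst//.
apply: (@le_trans _ _ (Rintegral (@leb3 R) B (fun p => f (vec3 p)))).
  apply: le_Rintegral => //; apply/integrableP; split; first exact: measurable_cst.
  rewrite [ltLHS](_ : _ = \int[@leb3 R]_(x in B) `|f v0 / 2|%:E)%E//.
  by rewrite integral_cst// [X in (_ * X)%E]lB -EFinM ltry.
(* Passing from the cube to the whole space only increases the integral, since [f] is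
   nonnegative. *)
rewrite fine_le//.
- exact: integrable_fin_num.
- exact: integrable_fin_num.
- apply: ge0_subset_integral => //.
  + by case/integrableP: fi.
  + by move=> p _; rewrite lee_fin.
Qed.

Lemma vint_eq0 f : continuous f -> vintegrable f -> (forall v, 0 <= f v) ->
  vint f = 0 -> forall v, f v = 0.
Proof.
move=> cf fi f0 If v; apply/eqP; rewrite eq_le f0 andbT leNgt; apply/negP.
by move=> /(vint_gt0 cf fi f0); rewrite If ltxx.
Qed.

(** Tonelli, applied once for each of the two nested product measures, splits the integral into
    three one-dimensional ones, each equal to 1. *)
Lemma vint_normal_pdf (u : vec R) (s : R) :
  vint (fun v => normal_pdf (u 0 0) s (v 0 0) *
    (normal_pdf (u 0 1) s (v 0 1) *
     normal_pdf (u 0 (inord 2)) s (v 0 (inord 2)))) = 1.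
Proof.
rewrite /vint /Rintegral.
under eq_integral => p _ do (have [-> -> ->] := vec3E p).
set k := fun i => normal_pdf (u 0 i) s.
have mk i : measurable_fun setT (k i) by exact: measurable_normal_pdf.
have k0 i x : 0 <= k i x by exact: normal_pdf_ge0.
have Ik i : (\int[lebesgue_measure]_x (k i x)%:E = 1)%E.
  exact: integral_normal_pdf.
have mk2 : measurable_fun setT (fun p : R * R => k 1 p.1 * k (inord 2) p.2).
  apply: measurable_funM.
    exact: (measurableT_comp (mk 1) measurable_fst).
  exact: (measurableT_comp (mk (inord 2)) measurable_snd).
have mk3 : measurable_fun setT
    (fun p : R * (R * R) => k 0 p.1 * (k 1 p.2.1 * k (inord 2) p.2.2)).
  apply: measurable_funM.
    exact: (measurableT_comp (mk 0) measurable_fst).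
  exact: (measurableT_comp mk2 measurable_snd).
have I2 : (\int[@leb2 R]_p (k 1 p.1 * k (inord 2) p.2)%:E = 1)%E.
  rewrite /leb2 fubini_tonelli1 /fubini_F /=; last 2 first.
  - exact/measurable_EFinP.
  - by move=> p; rewrite lee_fin mulr_ge0.
  rewrite -(Ik 1); apply: eq_integral => x _.
  under eq_integral do rewrite EFinM.
  rewrite ge0_integralZl ?lee_fin//; last by move=> y _; rewrite lee_fin.
    by rewrite Ik mule1.
  by apply/measurable_EFinP; exact: mk.
change (fine (\int[@leb3 R]_p (k 0 p.1 * (k 1 p.2.1 * k (inord 2) p.2.2))%:E)%E = 1).
rewrite /leb3 fubini_tonelli1 /fubini_F /=; last 2 first.
- exact/measurable_EFinP.
- by move=> p; rewrite lee_fin !mulr_ge0.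
rewrite (_ : integral _ _ _ = 1%E)// -(Ik 0); apply: eq_integral => x _.
under eq_integral do rewrite EFinM.
rewrite ge0_integralZl ?lee_fin//; last by move=> y _; rewrite lee_fin mulr_ge0.
  by rewrite I2 mule1.
exact/measurable_EFinP.
Qed.

End VelocityIntegral.

(** * Calculus rules for directional derivatives *)

Section DirectionalDerivative.
Context {R : realType} {V : normedModType R}.
Implicit Types (f h : V -> R) (x d : V).

(** The two difference quotients are the same function of the increment, so directional derivatives
    reduce to derivatives in one real variable. *)
Lemma is_derive_line f x d k b :
  is_derive (k *: d + x) d f b <-> is_derive k 1 (fun s : R => f (s *: d + x)) b.
Proof.
pose g (s : R) := f (s *: d + x).
have E : (fun s : R => s^-1 *: ((f \o shift (k *: d + x)) (s *: d)
                               - f (k *: d + x))) =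
    (fun s : R => s^-1 *: ((g \o shift k) (s *: 1) - g k)).
  apply/funext => s; congr (_ *: (f _ - _)); rewrite /shift.
  by rewrite [s *: 1]mulr1 scalerDl addrA.
have dE : derivable f (k *: d + x) d = derivable g k 1.
  by rewrite /derivable E.
have vE : 'D_d f (k *: d + x) = 'D_1 g k.
  by rewrite /derive E.
rewrite -/g; split=> -[df Df]; split.
- by rewrite -dE.
- by rewrite -vE.
- by rewrite dE.
- by rewrite vE.
Qed.

(** Restricting [f] to the line through [x] along [d] turns this into the one-variable chain rule;
    differentiability of [f] in that single direction suffices. *)
Lemma is_derive_comp_scalar (phi : R -> R) f x d a b :
  is_derive (f x) 1 phi a -> is_derive x d f b ->
  is_derive x d (fun y => phi (f y)) (a * b).
Proof.
move=> dphi df; have E : x = 0 *: d + x by rewrite scale0r add0r.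
rewrite E; apply/is_derive_line.
by apply: is_derive1_comp; rewrite -?E//; apply/is_derive_line; rewrite -E.
Qed.

Lemma continuous_add f h : continuous f -> continuous h ->
  continuous (fun x => f x + h x).
Proof. by move=> cf ch x; exact: cvgD (cf x) (ch x). Qed.

Lemma continuous_sub f h : continuous f -> continuous h ->
  continuous (fun x => f x - h x).
Proof. by move=> cf ch x; exact: cvgB (cf x) (ch x). Qed.

Lemma continuous_mul f h : continuous f -> continuous h ->
  continuous (fun x => f x * h x).
Proof. by move=> cf ch x; exact: cvgM (cf x) (ch x). Qed.

Lemma continuous_inv f : (forall x, f x != 0) -> continuous f ->
  continuous (fun x => (f x)^-1).
Proof. by move=> f0 cf x; exact: cvgV (f0 x) (cf x). Qed.

Lemma is_derive_add f h x d a b : is_derive x d f a -> is_derive x d h b ->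
  is_derive x d (fun y => f y + h y) (a + b).
Proof. exact: is_deriveD. Qed.

Lemma is_derive_sub f h x d a b : is_derive x d f a -> is_derive x d h b ->
  is_derive x d (fun y => f y - h y) (a - b).
Proof. exact: is_deriveB. Qed.

Lemma is_derive_mul f h x d a b : is_derive x d f a -> is_derive x d h b ->
  is_derive x d (fun y => f y * h y) (f x * b + h x * a).
Proof. exact: is_deriveM. Qed.

(** The quotient rule is arranged around the ratio [f x / h x], the form in which derivatives of
    [G / F] and [f / M] occur below. *)
Lemma is_derive_div f h x d a b : h x != 0 ->
  is_derive x d f a -> is_derive x d h b ->
  is_derive x d (fun y => f y / h y) ((a - f x / h x * b) / h x).
Proof.
move=> hx df dh.
have dV : is_derive x d (fun y => (h y)^-1) (- (h x) ^- 2 * b).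
  by split; [exact: derivableV|rewrite deriveV// derive_val].
apply: is_derive_eq (is_derive_mul df dV) _.
by field.
Qed.

Lemma smooth_is_derive f x d : smooth f -> is_derive x d f ('D_d f x).
Proof. by move=> sf; apply/derivableP/diff_derivable; exact: (sf [::]). Qed.

Lemma smooth_continuous f : smooth f -> continuous f.
Proof. by move=> sf x; apply: differentiable_continuous; exact: (sf [::]). Qed.

Lemma smooth_derive_continuous f d : smooth f -> continuous ('D_d f).
Proof. by move=> sf x; apply: differentiable_continuous; exact: (sf [:: d]). Qed.

End DirectionalDerivative.

(** * Gradients of the velocity weights, and functions with zero gradient *)

Section VelocityCalculus.
Context {R : realType}.
Implicit Types (f : vec R -> R) (v w u d : vec R).

Lemma vecZE k v i : (k *: v) 0 i = k * v 0 i.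
Proof. exact: mxE. Qed.

Lemma gradE f v i : grad f v 0 i = 'D_(basis R i) f v.
Proof. exact: mxE. Qed.

Lemma vec_basis v : v = \sum_i v 0 i *: basis R i.
Proof. exact: row_sum_delta. Qed.

(** Differentiability makes the derivative linear in the direction, so vanishing partial derivatives
    kill every directional one; [f] is then constant along the line joining [w] to [v]. *)
Lemma grad0_cst f : (forall v, differentiable f v) ->
  (forall v, grad f v = 0) -> forall v w, f v = f w.
Proof.
move=> df gf0 v w.
have D0 d x : is_derive x d f 0.
  apply: is_derive_eq; first exact/derivableP/diff_derivable.
  rewrite deriveE// (vec_basis d) linear_sum big1// => i _.
  rewrite linearZ /= -deriveE//.
  by have /rowP/(_ i) := gf0 x; rewrite !mxE => ->; rewrite scaler0.
pose g (s : R) := f (s *: (v - w) + w).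
have -> : f v = g 1 by rewrite /g scale1r subrK.
have -> : f w = g 0 by rewrite /g scale0r add0r.
have Dg (s : R) : is_derive s (1 : R) g 0.
  exact: (is_derive_line f w (v - w) s 0).1 (D0 _ _).
exact: is_derive_0_is_cst Dg.
Qed.

Lemma is_derive_coord v d i : is_derive v d (fun w => w 0 i) (d 0 i).
Proof.
have E : v = 0 *: d + v by rewrite scale0r add0r.
rewrite E; apply/is_derive_line.
rewrite (_ : (fun s : R => _) = (fun s : R => s * d 0 i + v 0 i)); last first.
  by apply/funext => s; rewrite !mxE.
apply: is_derive_eq.
by rewrite scale0r add0r addr0 [_%:A]mulr1.
Qed.

Lemma is_derive_sqn v d u :
  is_derive v d (fun w => sqn (w - u)) (2 * dot d (v - u)).
Proof.
rewrite /sqn /dot !big_ord3.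
rewrite (_ : (fun w => _) = fun w : vec R => (w 0 0 - u 0 0) * (w 0 0 - u 0 0) +
   (w 0 1 - u 0 1) * (w 0 1 - u 0 1) +
   (w 0 (inord 2) - u 0 (inord 2)) * (w 0 (inord 2) - u 0 (inord 2))); last first.
  by apply/funext => w; rewrite big_ord3 !mxE.
have D i : is_derive v d (fun w => w 0 i - u 0 i) (d 0 i - 0).
  by apply: is_derive_sub; exact: is_derive_coord.
have D2 i := is_derive_mul (D i) (D i).
apply: is_derive_eq (is_derive_add (is_derive_add (D2 0) (D2 1)) (D2 (inord 2))) _.
by rewrite !mxE; ring.
Qed.

Lemma grad_cst (c : R) v : grad (fun=> c) v = 0.
Proof. by apply/rowP => i; rewrite !mxE derive_cst. Qed.

Lemma grad_coord i v : grad (fun w => w 0 i) v = basis R i.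
Proof.
by apply/rowP => j; have Di := is_derive_coord v (basis R j) i;
  rewrite !mxE derive_val !mxE eqxx eq_sym.
Qed.

Lemma basisE i j : basis R i 0 j = (i == j)%:R.
Proof. by rewrite mxE eqxx eq_sym. Qed.

Lemma dot_basis i v : dot (basis R i) v = v 0 i.
Proof.
rewrite /dot (bigD1 i)//= basisE eqxx mul1r big1 ?addr0// => j ji.
by rewrite basisE eq_sym (negbTE ji) mul0r.
Qed.

Lemma grad_sqn v : grad (@sqn R) v = 2 *: v.
Proof.
apply/rowP => i; have := is_derive_sqn v (basis R i) 0.
under eq_fun do rewrite subr0.
by move=> Di; rewrite !mxE derive_val dot_basis subr0.
Qed.

End VelocityCalculus.

(** * Temperatures, energies and the partial derivatives of the entropy density *)

Section Gas.
Context {R : realType} (g : gas R).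

Lemma eint_continuous_itv (a b : R) : 0 < a ->
  {within `[a, b], continuous (eint g)}.
Proof.
move=> a0; apply: derivable_within_continuous => x.
by rewrite in_itv /= => /andP[ax _]; apply: eint_derivable; exact: lt_le_trans ax.
Qed.

Lemma eint_lt (a b : R) : 0 < a -> a < b -> eint g a < eint g b.
Proof.
move=> a0 ab; apply: (@gtr0_derive1_lt_cc _ (eint g) a b).
- move=> x; rewrite in_itv /= => /andP[ax _]; apply: eint_derivable.
  exact: lt_trans ax.
- move=> x; rewrite in_itv /= => /andP[ax _]; apply: cv_gt0.
  exact: lt_trans ax.
- exact: eint_continuous_itv.
- by rewrite in_itv /= lexx ltW.
- by rewrite in_itv /= lexx ltW.
- by [].
Qed.

Lemma eint_le (a b : R) : 0 < a -> a <= b -> eint g a <= eint g b.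
Proof. by move=> a0; rewrite le_eqVlt => /predU1P[->//|/(eint_lt a0)/ltW]. Qed.

(** Monotonicity of [eint] forces [a <= b], and the intermediate value theorem applies on this
    interval of positive temperatures. *)
Lemma Jint_between (a b y : R) : 0 < a -> 0 < b ->
  eint g a <= y <= eint g b -> Jint g y.
Proof.
move=> a0 b0 /andP[ay yb].
have ab : a <= b.
  by rewrite leNgt; apply/negP => /(eint_lt b0); rewrite ltNge (le_trans ay yb).
have [||c] := @IVT _ (eint g) a b y ab; first exact: eint_continuous_itv.
  by rewrite ge_min ay /= le_max yb orbT.
by rewrite in_itv /= => /andP[ac _] <-; exists c => //=; exact: lt_le_trans ac.
Qed.

(** Again the intermediate value theorem; [TtotK] will later identify the temperature found with the
    value of [Ttot]. *)
Lemma total_energy_between (a b y : R) : 0 < a -> a <= b ->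
  3 / 2 * gasR g * a + eint g a <= y <= 3 / 2 * gasR g * b + eint g b ->
  exists2 T, 0 < T & 3 / 2 * gasR g * T + eint g T = y.
Proof.
move=> a0 ab /andP[ay yb].
have [||c] := @IVT _ (fun T => 3 / 2 * gasR g * T + eint g T) a b y ab.
- apply: derivable_within_continuous => x.
  rewrite in_itv /= => /andP[ax _]; apply: derivableD => //.
  by apply: eint_derivable; exact: lt_le_trans ax.
- by rewrite ge_min ay /= le_max yb orbT.
- by rewrite in_itv /= => /andP[ac _] <-; exists c => //; exact: lt_le_trans ac.
Qed.

Lemma is_derive_Tint (T : R) : 0 < T ->
  is_derive (eint g T) 1 (Tint g) (derive1 (eint g) T)^-1.
Proof.
move=> T0; apply: is_derive_inverse.
- near=> x; apply: TintK; near: x; exact: lt_nbhsr.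
- near=> x; apply: differentiable_continuous; apply/derivable1_diffP.
  by apply: eint_derivable; near: x; exact: lt_nbhsr.
- by rewrite derive1E; apply/derivableP; exact: eint_derivable.
- by rewrite gt_eqF// cv_gt0.
Unshelve. all: by end_near. Qed.

(** Stated along arbitrary [f] and [h], so that one computation yields both partial derivatives of
    [Hent] and the chain rule in time and space. *)
Lemma is_derive_Hent (V : normedModType R) (f h : V -> R) (x d : V) df dh :
  0 < f x -> Jint g (h x / f x) -> is_derive x d f df -> is_derive x d h dh ->
  is_derive x d (fun y => Hent g (f y) (h y))
    ((ln (f x) + 1
        - (sint g (h x / f x) - h x / f x / Tint g (h x / f x)) / gasR g) * df
     - (gasR g * Tint g (h x / f x))^-1 * dh).
Proof.
move=> f0 [T T0 ET] Df Dh; have fx0 : f x != 0 by rewrite gt_eqF.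
have r0 : gasR g != 0 by rewrite gt_eqF// gasR_gt0.
have Tn0 : T != 0 by rewrite gt_eqF.
have Dln := is_derive_comp_scalar (is_derive1_ln f0) Df.
have Ds := sint_derive g T0; rewrite ET in Ds.
have Dsint := is_derive_comp_scalar (f := fun y => h y / f y) Ds
  (is_derive_div fx0 Dh Df).
have Dr := is_derive_div (h := fun=> gasR g) r0 Df (is_derive_cst _ x d).
have DH := is_derive_sub (is_derive_mul Df Dln) (is_derive_mul Dr Dsint).
apply: is_derive_eq DH _.
rewrite -ET TintK// ET.
by field; rewrite Tn0 r0 fx0.
Qed.

Lemma dHentFE (a b : R) : 0 < a -> Jint g (b / a) -> dHentF g a b =
  ln a + 1 - (sint g (b / a) - b / a / Tint g (b / a)) / gasR g.
Proof.
move=> a0 Jb; rewrite /dHentF derive1E.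
have D := is_derive_Hent (f := id) (h := fun=> b) a0 Jb
  (is_derive_id a 1) (is_derive_cst b a 1).
by rewrite derive_val mulr1 mulr0 subr0.
Qed.

Lemma dHentGE (a b : R) : 0 < a -> Jint g (b / a) ->
  dHentG g a b = - (gasR g * Tint g (b / a))^-1.
Proof.
move=> a0 Jb; rewrite /dHentG derive1E.
have D := is_derive_Hent (f := fun=> a) (h := id) a0 Jb
  (is_derive_cst a b 1) (is_derive_id b 1).
by rewrite derive_val mulr1 mulr0 sub0r.
Qed.

End Gas.

(** * Moments of [F] and [G], and the existence of a positive temperature *)

Section Moments.
Context {R : realType} (g : gas R) (F G : vec R -> R).
Context (FGreg : velocity_regular g F G).
Let u := bulk F.
Let T := temp g F G.

Let contF : continuous F. Proof. exact: smooth_continuous (vreg_smoothF FGreg). Qed.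
Let contG : continuous G. Proof. exact: smooth_continuous (vreg_smoothG FGreg). Qed.
Let massF := vreg_mass FGreg.
Let massG := vreg_energyG FGreg.

Lemma coord_continuous i : continuous (fun v : vec R => v 0 i).
Proof. by move=> v; exact/differentiable_continuous/differentiable_coord. Qed.

Lemma sqn_continuous (u0 : vec R) : continuous (fun v : vec R => sqn (v - u0)).
Proof.
rewrite (_ : (fun v => _) = fun v : vec R => (v 0 0 - u0 0 0) * (v 0 0 - u0 0 0) +
   (v 0 1 - u0 0 1) * (v 0 1 - u0 0 1) +
   (v 0 (inord 2) - u0 0 (inord 2)) * (v 0 (inord 2) - u0 0 (inord 2))); last first.
  by apply/funext => v; rewrite /sqn /dot big_ord3 !mxE.
have C i : continuous (fun v : vec R => v 0 i - u0 0 i).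
  by apply: continuous_sub; [exact: coord_continuous|exact: cst_continuous].
have C2 i := continuous_mul (C i) (C i).
exact: continuous_add (continuous_add (C2 0) (C2 1)) (C2 (inord 2)).
Qed.

Lemma sqn_ge0 (v : vec R) : 0 <= sqn v.
Proof. by apply: sumr_ge0 => i _; rewrite -expr2 sqr_ge0. Qed.

Lemma rho_gt0 : 0 < rho F.
Proof.
apply: (vint_gt0 contF massF _ (vreg_posF FGreg 0)) => v.
exact/ltW/(vreg_posF FGreg).
Qed.

Let rho_neq0 : rho F != 0. Proof. by rewrite gt_eqF// rho_gt0. Qed.

Lemma rho_bulk i : vint (fun v => v 0 i * F v) = rho F * u 0 i.
Proof. by rewrite /u mxE mulVKf. Qed.

Lemma integrable_rel_momentum i : vintegrable (fun v => (v 0 i - u 0 i) * F v).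
Proof.
under eq_fun do rewrite mulrBl.
by apply: vintegrableB; [exact: (vreg_momentum FGreg)|exact: vintegrableZl].
Qed.

Lemma rel_momentum i : vint (fun v => (v 0 i - u 0 i) * F v) = 0.
Proof.
under eq_fun do rewrite mulrBl.
rewrite vintB; [|exact: (vreg_momentum FGreg)|exact: vintegrableZl].
by rewrite rho_bulk vintZl// mulrC subrr.
Qed.

Lemma integrable_kinetic : vintegrable (fun v => sqn (v - u) * F v).
Proof.
have -> : (fun v => sqn (v - u) * F v) = fun v =>
    sqn v * F v + (\sum_i (- 2 * u 0 i) * (v 0 i * F v) + sqn u * F v).
  by apply/funext => v; rewrite /sqn /dot !big_ord3 !mxE; ring.
apply: vintegrableD; first exact: (vreg_energyF FGreg).
apply: vintegrableD; last exact: vintegrableZl.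
by apply: vintegrable_sum => i; apply: vintegrableZl; exact: (vreg_momentum FGreg).
Qed.

Lemma kinetic_energy :
  vint (fun v => sqn (v - u) * F v) = 2 * (rho F * energy F G - vint G).
Proof.
rewrite /energy mulVKf// addrK.
under [in RHS]eq_fun do rewrite -mulrA.
by rewrite vintZl ?mulVKf//; exact: integrable_kinetic.
Qed.

Lemma kinetic_energy_gt0 : 0 < vint (fun v => sqn (v - u) * F v).
Proof.
have F0 := vreg_posF FGreg.
(* At this point [v - u] is a unit vector, so the integrand equals [F v0], which is positive. *)
apply: (vint_gt0 _ integrable_kinetic _ (v0 := u + basis R 0)).
- by apply: continuous_mul; [exact: sqn_continuous|exact: contF].
- by move=> v; rewrite mulr_ge0 ?sqn_ge0// ltW.
- by rewrite mulr_gt0// addrC addKr /sqn dot_basis basisE eqxx.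
Qed.

(* If [G / F] stayed on one side of its F-average, then [G - m F] would have a
   sign and a zero integral. *)
Lemma mean_internal_energy : Jint g ((rho F)^-1 * vint G).
Proof.
set m := _ * _.
have F0 := vreg_posF FGreg.
have mF : vintegrable (fun v => m * F v) by exact: vintegrableZl.
have ImF : vint (fun v => m * F v) = vint G.
  by rewrite vintZl// /m mulrAC mulVf// mul1r.
have cmF : continuous (fun v => m * F v).
  by apply: continuous_mul => //; exact: cst_continuous.
have [v1 Hv1] : exists v, G v / F v <= m.
  apply: contrapT => /forallNP H.
  have pos v : 0 < G v - m * F v.
    by rewrite subr_gt0 -ltr_pdivlMr// ltNge; exact/negP/H.
  have := vint_gt0 (continuous_sub contG cmF) (vintegrableB massG mF)
    (fun v => ltW (pos v)) (pos 0).
  by rewrite vintB// ImF subrr ltxx.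
have [v2 Hv2] : exists v, m <= G v / F v.
  apply: contrapT => /forallNP H.
  have pos v : 0 < m * F v - G v.
    by rewrite subr_gt0 -ltr_pdivrMr// ltNge; exact/negP/H.
  have := vint_gt0 (continuous_sub cmF contG) (vintegrableB mF massG)
    (fun v => ltW (pos v)) (pos 0).
  by rewrite vintB// ImF subrr ltxx.
have [a a0 Ea] := vreg_J FGreg v1.
have [b b0 Eb] := vreg_J FGreg v2.
by apply: (Jint_between a0 b0); rewrite Ea Eb Hv1 Hv2.
Qed.

(* [e] lies between the values of the total energy at the kinetic temperature
   [t] and the mean internal temperature [th], hence is attained. *)
Lemma temp_energy : 0 < T /\ energy F G = 3 / 2 * gasR g * T + eint g T.
Proof.
have r0 := gasR_gt0 g.
have [th th0 Eth] := mean_internal_energy.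
pose t := vint (fun v => sqn (v - u) * F v) / (3 * gasR g * rho F).
have t0 : 0 < t by rewrite divr_gt0 ?kinetic_energy_gt0// !mulr_gt0// rho_gt0.
have Ee : energy F G = 3 / 2 * gasR g * t + eint g th.
  by rewrite Eth /t kinetic_energy; field; rewrite rho_neq0 gt_eqF.
have k0 : 0 <= 3 / 2 * gasR g by rewrite mulr_ge0 ?divr_ge0// ltW.
have m0 : 0 < Num.min th t by rewrite lt_min th0.
have [||T0 T00 ET0] := @total_energy_between R g (Num.min th t) (Num.max th t)
  (energy F G) m0.
- by rewrite ge_min le_max lexx.
- rewrite Ee !lerD// ?ler_wpM2l//.
  + by rewrite le_max lexx orbT.
  + by apply: eint_le => //; rewrite le_max lexx.
  + by rewrite ge_min lexx orbT.
  + by apply: eint_le => //; rewrite ge_min lexx.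
have -> : T = T0 by rewrite /T /temp -ET0 TtotK.
by [].
Qed.

Lemma temp_gt0 : 0 < T. Proof. exact: temp_energy.1. Qed.

Lemma div3_basis i v :
  div3 (fun w => F w *: basis R i) v = 'D_(basis R i) F v.
Proof.
rewrite /div3 (bigD1 i)//= big1 => [|j ji]; last first.
  rewrite (_ : (fun w => _) = fun=> 0) ?derive_cst//.
  by apply/funext => w; rewrite mxE basisE eq_sym (negbTE ji) mulr0.
rewrite addr0; congr ('D_ _ _ _); apply/funext => w.
by rewrite mxE basisE eqxx mulr1.
Qed.

Lemma integrable_grad i : vintegrable ('D_(basis R i) F).
Proof.
have [+ _ _] := vreg_grad1 FGreg i.
by under eq_fun do rewrite mul1r div3_basis.
Qed.

Lemma int_grad i : vint ('D_(basis R i) F) = 0.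
Proof.
have [_ _] := vreg_grad1 FGreg i.
under eq_fun do rewrite mul1r div3_basis.
move=> ->; rewrite -[RHS]oppr0; congr (- _).
under eq_fun => v.
  rewrite grad_cst /dot big1; last by move=> j _; rewrite mxE mul0r.
  over.
by rewrite /vint Rintegral_cst// mul0r.
Qed.

Lemma integrable_coord_grad i j :
  vintegrable (fun v => v 0 j * 'D_(basis R i) F v).
Proof.
have [+ _ _] := vreg_gradv FGreg i j.
by under eq_fun do rewrite div3_basis.
Qed.

Lemma int_coord_grad i :
  vint (fun v => v 0 i * 'D_(basis R i) F v) = - rho F.
Proof.
have [_ _] := vreg_gradv FGreg i i.
under eq_fun do rewrite div3_basis.
move=> ->; congr (- vint _); apply/funext => v.
by rewrite grad_coord dot_basis mxE basisE eqxx mulr1.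
Qed.

Lemma integrable_rel_grad i :
  vintegrable (fun v => (v 0 i - u 0 i) * 'D_(basis R i) F v).
Proof.
under eq_fun do rewrite mulrBl.
apply: vintegrableB; first exact: integrable_coord_grad.
by apply: vintegrableZl; exact: integrable_grad.
Qed.

Lemma int_rel_grad i :
  vint (fun v => (v 0 i - u 0 i) * 'D_(basis R i) F v) = - rho F.
Proof.
have Ii := integrable_grad i.
under eq_fun do rewrite mulrBl.
rewrite vintB ?vintZl// ?int_grad ?int_coord_grad ?mulr0 ?subr0//.
  exact: integrable_coord_grad.
exact: vintegrableZl.
Qed.

Lemma fluxE f v i : flux g F G f v 0 i =
  f v * (v 0 i - u 0 i) + gasR g * T * 'D_(basis R i) f v.
Proof. by rewrite !mxE. Qed.

Lemma integrable_flux i : vintegrable (fun v => flux g F G F v 0 i).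
Proof.
under eq_fun do rewrite fluxE mulrC.
apply: vintegrableD; first exact: integrable_rel_momentum.
by apply: vintegrableZl; exact: integrable_grad.
Qed.

Lemma int_flux i : vint (fun v => flux g F G F v 0 i) = 0.
Proof.
have Ii := integrable_grad i.
under eq_fun do rewrite fluxE mulrC.
rewrite vintD ?vintZl// ?rel_momentum ?int_grad ?mulr0 ?addr0//.
  exact: integrable_rel_momentum.
exact: vintegrableZl.
Qed.

(** The defining relation of [T]: [kinetic_energy] expresses the kinetic part through [e], and
    inserting [e = 3/2 R T + eint T] cancels the translational energy. *)
Lemma int_thermal :
  vint (fun v => sqn (v - u) * F v) - 3 * (gasR g * T) * rho F =
  2 * (eint g T * rho F - vint G).
Proof.
by rewrite kinetic_energy temp_energy.2; field.
Qed.

End Moments.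

(** * Integration by parts against [1], [v_i] and [|v|^2] *)

Section IntegrationByParts.
Context {R : realType}.
Implicit Types Phi : vec R -> vec R.

Lemma ibp1 Phi : ibp (fun=> 1) Phi ->
  vintegrable (div3 Phi) /\ vint (div3 Phi) = 0.
Proof.
case; under eq_fun do rewrite mul1r.
move=> Pi _ ->; split=> //.
under eq_fun => v.
  rewrite grad_cst /dot big1; last by move=> j _; rewrite mxE mul0r.
  over.
by rewrite /vint Rintegral_cst// mul0r oppr0.
Qed.

Lemma ibp_coord i Phi : ibp (fun v => v 0 i) Phi ->
  vint (fun v => v 0 i * div3 Phi v) = - vint (fun v => Phi v 0 i).
Proof.
by case=> _ _ ->; under [in LHS]eq_fun do rewrite grad_coord dot_basis.
Qed.

Lemma ibp_sqn Phi : ibp (fun v => sqn v) Phi ->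
  vintegrable (fun v => sqn v * div3 Phi v) /\
  vint (fun v => sqn v * div3 Phi v) = - vint (fun v => 2 * dot v (Phi v)).
Proof.
case=> Pi _ ->; split=> //; congr (- vint _); apply/funext => v.
rewrite grad_sqn /dot mulr_sumr; apply: eq_bigr => i _.
by rewrite mxE mulrA.
Qed.

End IntegrationByParts.

(** * Conservation of mass, momentum and energy *)

Section Conservation.
Context {R : realType} (g : gas R) (F G : vec R -> R).
Context (FGreg : velocity_regular g F G).
Let u := bulk F.
Let T := temp g F G.
Let massF := vreg_mass FGreg.
Let massG := vreg_energyG FGreg.

Let ibp_poly phi (w : poly_weights phi) := vreg_flux FGreg w.

Lemma int_div_flux :
  [/\ vintegrable (div3 (flux g F G F)), vintegrable (div3 (flux g F G G)),
      vint (div3 (flux g F G F)) = 0 & vint (div3 (flux g F G G)) = 0].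
Proof.
have [/ibp1[iF vF] /ibp1[iG vG]] := ibp_poly (Or31 _ _ erefl).
by split.
Qed.

Lemma integrable_flux_work : vintegrable (fun v =>
  sqn (v - u) * F v
  + \sum_i gasR g * T * ((v 0 i - u 0 i) * 'D_(basis R i) F v)).
Proof.
apply: vintegrableD; first exact: (integrable_kinetic FGreg).
apply: vintegrable_sum => i; apply: vintegrableZl.
exact: (integrable_rel_grad FGreg).
Qed.

(** Each of the three gradient terms integrates to [- R T rho], which leaves the left-hand side of
    [int_thermal]. This balance serves both conservation of energy and the H-theorem. *)
Lemma int_flux_work : vint (fun v =>
  sqn (v - u) * F v
  + \sum_i gasR g * T * ((v 0 i - u 0 i) * 'D_(basis R i) F v)) =
  2 * (eint g T * rho F - vint G).
Proof.
have Ii i : vintegrable (fun v =>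
    gasR g * T * ((v 0 i - u 0 i) * 'D_(basis R i) F v)).
  by apply: vintegrableZl; exact: (integrable_rel_grad FGreg).
rewrite vintD; [|exact: (integrable_kinetic FGreg)|exact: vintegrable_sum].
rewrite vint_sum// -(int_thermal FGreg) -/u -/T.
under eq_bigr => i _.
  rewrite vintZl; last exact: (integrable_rel_grad FGreg).
  rewrite (int_rel_grad FGreg).
  over.
by rewrite sumr_const card_ord; ring.
Qed.

(** Writing [v = (v - u) + u] isolates the relative work; the remaining part is a fixed combination
    of flux components, each of zero integral. *)
Lemma dot_fluxF v : dot v (flux g F G F v) =
  (sqn (v - u) * F v
   + \sum_i gasR g * T * ((v 0 i - u 0 i) * 'D_(basis R i) F v))
  + \sum_i u 0 i * flux g F G F v 0 i.
Proof.
rewrite /sqn /dot !big_ord3 !fluxE -/u -/T !mxE.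
move: (v 0 0) (v 0 1) (v 0 (inord 2)) ('D_(basis R 0) F v)
  ('D_(basis R 1) F v) ('D_(basis R (inord 2)) F v) (F v) => *.
by ring.
Qed.

Lemma int_dot_fluxF :
  vint (fun v => 2 * dot v (flux g F G F v)) =
  4 * (eint g T * rho F - vint G).
Proof.
have If i : vintegrable (fun v => u 0 i * flux g F G F v 0 i).
  by apply: vintegrableZl; exact: (integrable_flux FGreg).
have Iw := integrable_flux_work.
under eq_fun do rewrite dot_fluxF.
rewrite vintZl; last by apply: vintegrableD => //; exact: vintegrable_sum.
rewrite vintD//; last exact: vintegrable_sum.
rewrite int_flux_work vint_sum// big1 ?addr0; first by ring.
move=> i _; rewrite vintZl; last exact: (integrable_flux FGreg).
by rewrite (int_flux FGreg) mulr0.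
Qed.

Lemma conservation (tau : R) :
  [/\ vint (collF g tau F G) = 0,
      forall i : 'I_3, vint (fun v => v 0 i * collF g tau F G v) = 0 &
      vint (fun v => 2^-1 * sqn v * collF g tau F G v + collG g tau F G v) = 0].
Proof.
have [iF iG vF vG] := int_div_flux.
have coords i : poly_weights (fun v : vec R => v 0 i) by apply: Or32; exists i.
split.
- by rewrite /collF vintZl// vF mulr0.
- move=> i; have [ibpF _] := ibp_poly (coords i).
  have [iiF _ _] := ibpF.
  under eq_fun do rewrite mulrCA.
  by rewrite vintZl// ibp_coord// (int_flux FGreg) oppr0 mulr0.
- have [/ibp_sqn[isF vsF] _] := ibp_poly (Or33 _ _ erefl).
  have -> : (fun v => 2^-1 * sqn v * collF g tau F G v + collG g tau F G v) =
      fun v => (2^-1 * tau^-1) * (sqn v * div3 (flux g F G F) v) +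
        (tau^-1 * div3 (flux g F G G) v +
         2 / tau * (eint g T * F v - G v)).
    apply/funext => v; rewrite /collF /collG -/T.
    move: (sqn v) (div3 _ v) (div3 _ v) (eint g T) (F v) (G v) => *.
    by ring.
  have Ie : vintegrable (fun v => eint g T * F v) by exact: vintegrableZl.
  have Ir : vintegrable (fun v => eint g T * F v - G v) by exact: vintegrableB.
  have vR : vint (fun v => eint g T * F v - G v) = eint g T * rho F - vint G.
    by rewrite (vintB Ie massG) (vintZl _ massF).
  apply: etrans (vint_comb3 _ _ _ isF iG Ir vsF vG vR) _.
  (* The factor [2^-1] times [- 4] from the kinetic part cancels the [2] of the relaxation term; the
     divergence of the flux of [G] contributes zero. *)
  rewrite int_dot_fluxF.
  by move: (tau^-1) (eint g T) (rho F) (vint G) => *; field.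
Qed.

End Conservation.

(** * The Maxwellian and the characterization of equilibria *)

Section Maxwellian.
Context {R : realType} (g : gas R) (F G : vec R -> R).
Context (FGreg : velocity_regular g F G).
Let u := bulk F.
Let T := temp g F G.
Let M := maxwellian g F G.
Let theta := gasR g * T.

Let theta0 : 0 < theta.
Proof. by rewrite mulr_gt0 ?gasR_gt0// (temp_gt0 FGreg). Qed.

Lemma maxwellian_gt0 v : 0 < M v.
Proof.
rewrite mulr_gt0 ?expR_gt0// divr_gt0 ?(rho_gt0 FGreg)// powR_gt0//.
by rewrite -mulrA mulr_gt0// mulr_gt0// pi_gt0.
Qed.

Let M_neq0 v : M v != 0. Proof. by rewrite gt_eqF// maxwellian_gt0. Qed.

Lemma is_derive_maxwellian v i :
  is_derive v (basis R i) M (- ((v 0 i - u 0 i) / theta) * M v).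
Proof.
have Ds := is_derive_sqn v (basis R i) u.
(* With this constant and the prefactor [K], the Maxwellian is [K * expR (c * sqn (w - u))], ready
   for the chain rule. *)
pose c := - (2 * theta)^-1.
have De := is_derive_comp_scalar (f := fun w => c * sqn (w - u)) (is_derive_expR _)
  (is_derive_mul (is_derive_cst c v (basis R i)) Ds).
pose K := rho F / (2 * pi * gasR g * T) `^ (3 / 2).
have := is_derive_mul (is_derive_cst K v (basis R i)) De.
have -> : (fun w => K * expR (c * sqn (w - u))) = M.
  apply/funext => w; rewrite /M /maxwellian -/u -/T -/K; congr (_ * expR _).
  by rewrite /c /theta mulNr mulrC -[2 * _ * _]mulrA.
move=> DM; apply: is_derive_eq DM _.
have -> : M v = K * expR (c * sqn (v - u)).
  rewrite /M /maxwellian -/u -/T -/K; congr (_ * expR _).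
  by rewrite /c /theta mulNr [in RHS]mulrC -[2 * _ * _]mulrA.
rewrite dot_basis !mxE /cst /c; field.
by rewrite !gt_eqF// (rho_gt0 FGreg).
Qed.

(** Full differentiability, beyond partial derivatives, provides continuity of [M] and lets
    [grad0_cst] apply to [f / M]. *)
Lemma differentiable_maxwellian v : differentiable M v.
Proof.
have dsq : differentiable (fun w : vec R => sqn (w - u)) v.
  have -> : (fun w : vec R => sqn (w - u)) =
      \sum_(i < 3) (fun w : vec R => (w 0 i - u 0 i) * (w 0 i - u 0 i)).
    by apply/funext => w; rewrite fct_sumE; apply: eq_bigr => i _; rewrite !mxE.
  apply: differentiable_sum => i.
  apply: differentiableM; apply: differentiableB => //;
    exact: differentiable_coord.
apply: differentiableM => //.
apply: (@differentiable_comp _ _ _ _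
  (fun w => - (sqn (w - u) / (2 * gasR g * T))) expR).
  by apply: differentiableN; apply: differentiableM.
by apply/derivable1_diffP; exact: derivable_expR.
Qed.

(** The logarithmic gradient of [M] is [- (v - u) / (R T)], so drift and diffusion cancel. *)
Lemma flux_maxwellian f c : (forall v, f v = c * M v) ->
  forall v, flux g F G f v = 0.
Proof.
move=> fE v; apply/rowP => i; rewrite fluxE -/u -/T.
have -> : f = fun w => c * M w by exact/funext.
have D := is_derive_mul (is_derive_cst c v _) (is_derive_maxwellian v i).
rewrite derive_val [RHS]mxE /cst -/theta /=; field.
by rewrite gt_eqF.
Qed.

Lemma div_flux_maxwellian f c : (forall v, f v = c * M v) ->
  forall v, div3 (flux g F G f) v = 0.
Proof.
move=> /flux_maxwellian fl v; rewrite /div3 big1// => i _.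
rewrite (_ : (fun w => _) = fun=> 0) ?derive_cst//.
by apply/funext => w; rewrite fl mxE.
Qed.

(** Equivalently, the flux of [f] is [R T M grad (f / M)]: the Fokker-Planck operator in its
    symmetric form, which makes the dissipation a weighted square. *)
Lemma grad_ratio f v : smooth f ->
  grad (fun w => f w / M w) v = (theta * M v)^-1 *: flux g F G f v.
Proof.
move=> sf; apply/rowP => i; rewrite vecZE fluxE -/u -/T -/theta mxE.
have D := is_derive_div (M_neq0 v) (smooth_is_derive v (basis R i) sf)
  (is_derive_maxwellian v i).
rewrite derive_val; field.
by rewrite M_neq0 gt_eqF.
Qed.

Lemma dissipation_ratio f v : smooth f ->
  dot (grad (fun w => f w / M w) v) (flux g F G f v) =
  (theta * M v)^-1 * sqn (flux g F G f v).
Proof.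
move=> sf; rewrite grad_ratio// /sqn /dot mulr_sumr.
by apply: eq_bigr => i _; rewrite vecZE; exact/esym/mulrA.
Qed.

Lemma dissipation_ratio_ge0 f v : smooth f ->
  0 <= dot (grad (fun w => f w / M w) v) (flux g F G f v).
Proof.
move=> sf; rewrite dissipation_ratio// mulr_ge0 ?sqn_ge0// invr_ge0 ltW//.
by rewrite mulr_gt0// maxwellian_gt0.
Qed.

Let contM : continuous M.
Proof. by move=> v; exact/differentiable_continuous/differentiable_maxwellian. Qed.

Let contMV : continuous (fun v => (M v)^-1).
Proof. exact: continuous_inv. Qed.

(** A continuous nonnegative integrand of zero integral vanishes, so the flux is zero; by
    [grad_ratio] the quotient [f / M] then has zero gradient and is constant. *)
Lemma dissipation_eq0 f : smooth f ->
  vintegrable (fun v => dot (grad (fun w => f w / M w) v) (flux g F G f v)) ->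
  vint (fun v => dot (grad (fun w => f w / M w) v) (flux g F G f v)) = 0 ->
  exists c, forall v, f v = c * M v.
Proof.
move=> sf di d0.
have cflux i : continuous (fun v => flux g F G f v 0 i).
  under eq_fun do rewrite fluxE.
  apply: continuous_add; apply: continuous_mul.
  - exact: smooth_continuous.
  - by apply: continuous_sub; [exact: coord_continuous|exact: cst_continuous].
  - exact: cst_continuous.
  - exact: smooth_derive_continuous.
have cdiss : continuous
    (fun v => dot (grad (fun w => f w / M w) v) (flux g F G f v)).
  under eq_fun do rewrite dissipation_ratio// /sqn /dot big_ord3 invfM.
  apply: continuous_mul.
    by apply: continuous_mul => //; exact: cst_continuous.
  have c2 i := continuous_mul (cflux i) (cflux i).
  exact: continuous_add (continuous_add (c2 0) (c2 1)) (c2 (inord 2)).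
have flux0 v : sqn (flux g F G f v) = 0.
  have /eqP := vint_eq0 cdiss di (fun v => dissipation_ratio_ge0 v sf) d0 v.
  rewrite dissipation_ratio// mulf_eq0 invr_eq0 mulf_eq0 (negbTE (M_neq0 v)).
  by rewrite gt_eqF//= => /eqP.
have grad0 v : grad (fun w => f w / M w) v = 0.
  rewrite grad_ratio//; apply/rowP => i; rewrite vecZE [RHS]mxE.
  have /eqP := flux0 v; rewrite /sqn /dot psumr_eq0; last first.
    by move=> j _; rewrite -expr2 sqr_ge0.
  move=> /allP/(_ i (mem_index_enum _)) /=; rewrite mulf_eq0 orbb => /eqP.
  by move=> ->; rewrite mulr0.
have dfM v : differentiable (fun w => f w / M w) v.
  apply: differentiableM; first exact: (sf [::]).
  by apply: differentiableV => //; exact: differentiable_maxwellian.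
exists (f 0 / M 0) => v; rewrite (grad0_cst dfM grad0 0 v).
by rewrite divfK.
Qed.

Lemma maxwellian_normal v : M v = rho F *
  (normal_pdf (u 0 0) (Num.sqrt theta) (v 0 0) *
    (normal_pdf (u 0 1) (Num.sqrt theta) (v 0 1) *
     normal_pdf (u 0 (inord 2)) (Num.sqrt theta) (v 0 (inord 2)))).
Proof.
have s0 : Num.sqrt theta != 0 by rewrite gt_eqF// sqrtr_gt0.
rewrite !normal_pdfE// /normal_fun /normal_peak sqr_sqrtr ?(ltW theta0)//.
have -> : theta * pi *+ 2 = 2 * pi * gasR g * T.
  by rewrite /theta -mulr_natl; ring.
have a0 : 0 < 2 * pi * gasR g * T.
  by rewrite -mulrA mulr_gt0// mulr_gt0// pi_gt0.
have -> (x y z k : R) : rho F * (k * expR x * (k * expR y * (k * expR z))) =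
    rho F * k ^+ 3 * expR (x + y + z).
  by rewrite !expRD; ring.
rewrite /M /maxwellian -/u -/T; congr (_ * _ * expR _).
  (* The power 3/2 becomes the cube of a square root, one factor for each coordinate. *)
  have -> : 3 / 2 = 2^-1 * 3%:R :> R by ring.
  by rewrite powRrM powR_mulrn ?powR_ge0// powR12_sqrt ?ltW// exprVn.
rewrite /sqn /dot big_ord3 !mxE -mulr_natl /theta; field.
have T0 : 0 < T := temp_gt0 FGreg.
by rewrite !gt_eqF ?gasR_gt0// (rho_gt0 FGreg).
Qed.

(** Integrating [F = c M] gives [rho = c rho], because [M] is [rho] times a probability density;
    hence [c = 1]. *)
Lemma maxwellian_mass (c : R) : (forall v, F v = c * M v) -> F = M.
Proof.
move=> FE; have c0 : c != 0.
  apply/eqP => c0; have := vreg_posF FGreg 0.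
  by rewrite FE c0 mul0r ltxx.
pose N := fun v : vec R => normal_pdf (u 0 0) (Num.sqrt theta) (v 0 0) *
    (normal_pdf (u 0 1) (Num.sqrt theta) (v 0 1) *
     normal_pdf (u 0 (inord 2)) (Num.sqrt theta) (v 0 (inord 2))).
have r0 : rho F != 0 by rewrite gt_eqF// (rho_gt0 FGreg).
have FN : F = fun v => (c * rho F) * N v.
  by apply/funext => v; rewrite FE maxwellian_normal mulrA.
(* Integrability of the Gaussian is inherited from [F], of which it is a multiple since [c * rho F]
   is nonzero. *)
have iN : vintegrable N.
  have := vintegrableZl (c * rho F)^-1 (vreg_mass FGreg).
  under eq_fun => v.
    rewrite [X in _ * X](_ : F v = (c * rho F) * N v); last by rewrite [in LHS]FN.
    rewrite mulKf ?mulf_neq0//.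
    over.
  by [].
have : vint F = c * rho F by rewrite [in LHS]FN vintZl// vint_normal_pdf mulr1.
rewrite -/(rho F) => /esym /(canRL (mulfK r0)); rewrite divff// => c1.
by apply/funext => v; rewrite FE c1 mul1r.
Qed.

Lemma equilibrium (tau : R) : 0 < tau ->
  flux_ibp g F G (maxwellian_weights g F G) ->
  ((forall v, collF g tau F G v = 0) /\ (forall v, collG g tau F G v = 0))
  <->
  ((forall v, F v = M v) /\ (forall v, G v = eint g T * M v)).
Proof.
move=> tau0 ibpM; have tn0 : tau != 0 by rewrite gt_eqF.
have sF := vreg_smoothF FGreg; have sG := vreg_smoothG FGreg.
split=> [[cF cG]|[FM GM]]; last first.
  split=> v.
    rewrite /collF (div_flux_maxwellian (c := 1)) ?mulr0// => w.
    by rewrite mul1r FM.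
  by rewrite /collG (div_flux_maxwellian GM) GM FM subrr !mulr0 addr0.
have divF v : div3 (flux g F G F) v = 0.
  by have /eqP := cF v; rewrite mulf_eq0 invr_eq0 (negbTE tn0) => /eqP.
have [[_ dF vF] _] := ibpM _ (or_introl erefl).
have [c Fc] : exists c, forall v, F v = c * M v.
  apply: dissipation_eq0 => //; apply/eqP; rewrite -oppr_eq0 -vF; apply/eqP.
  under eq_fun do rewrite divF mulr0.
  by rewrite /vint Rintegral_cst// mul0r.
have FM := maxwellian_mass Fc; split; first by move=> v; rewrite {1}FM.
set e := eint g T.
pose psi v := G v / M v.
(* The equation of [G], solved for the divergence once [F = M] is known. *)
have divG v : div3 (flux g F G G) v = 2 * (M v * (psi v - e)).
  have /eqP := cG v; rewrite /collG -/T -/e.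
  have -> : F v = M v by rewrite {1}FM.
  rewrite -mulrA mulrCA -mulrDr mulf_eq0 invr_eq0 (negbTE tn0) /= addr_eq0.
  by move=> /eqP ->; rewrite /psi; field; exact: M_neq0.
have [_ iG _ vG] := int_div_flux FGreg.
have [_ [ipG dG vpG]] := ibpM _ (or_intror erefl).
(* Testing against [psi - e]: the constant [e] multiplies a divergence of zero integral, so only the
   integration by parts against [G / M] remains. *)
have relaxE : (fun v => 2 * (M v * (psi v - e) ^+ 2)) =
    fun v => psi v * div3 (flux g F G G) v - e * div3 (flux g F G G) v.
  by apply/funext => v; rewrite divG; ring.
have relax_ge0 v : 0 <= 2 * (M v * (psi v - e) ^+ 2).
  by rewrite mulr_ge0// mulr_ge0 ?sqr_ge0// ltW// maxwellian_gt0.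
(* This integral is nonnegative, and also equal to minus a nonnegative dissipation. *)
have relax_int : vint (fun v => 2 * (M v * (psi v - e) ^+ 2)) = 0.
  apply/eqP; rewrite eq_le vint_ge0// andbT relaxE.
  rewrite vintB//; last exact: vintegrableZl.
  rewrite vintZl// vG mulr0 subr0 vpG oppr_le0.
  by apply: vint_ge0 => v; exact: dissipation_ratio_ge0.
have cpsi : continuous (fun v => psi v - e).
  apply: continuous_sub; last exact: cst_continuous.
  by apply: continuous_mul => //; exact: smooth_continuous.
have crelax : continuous (fun v => 2 * (M v * (psi v - e) ^+ 2)).
  under eq_fun do rewrite expr2.
  apply: continuous_mul; first exact: cst_continuous.
  by apply: continuous_mul => //; exact: continuous_mul.
have irelax : vintegrable (fun v => 2 * (M v * (psi v - e) ^+ 2)).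
  by rewrite relaxE; apply: vintegrableB => //; exact: vintegrableZl.
move=> v; have /eqP := vint_eq0 crelax irelax relax_ge0 relax_int v.
rewrite mulf_eq0 pnatr_eq0 /= mulf_eq0 (negbTE (M_neq0 v)) /= expf_eq0 /= subr_eq0.
by rewrite /psi => /eqP <-; rewrite divfK.
Qed.

End Maxwellian.

(** * Sign of the entropy production of the collision operator *)

Section EntropyProduction.
Context {R : realType} (g : gas R) (F G : vec R -> R).
Context (FGreg : velocity_regular g F G).
Let u := bulk F.
Let T := temp g F G.
Let HF v := dHentF g (F v) (G v).
Let HG v := dHentG g (F v) (G v).
Let y v := G v / F v.
Let th v := Tint g (y v).
Let D i f v := 'D_(basis R i) f v : R.

Let F0 := vreg_posF FGreg.
Let F_neq0 v : F v != 0. Proof. by rewrite gt_eqF. Qed.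
Let r0 := gasR_gt0 g.
Let T0 : 0 < T := temp_gt0 FGreg.

Lemma internal_temp v : 0 < th v /\ eint g (th v) = y v.
Proof. by rewrite /th /y; have [t t0 <-] := vreg_J FGreg v; rewrite TintK. Qed.

Let th_neq0 v : th v != 0.
Proof. by rewrite gt_eqF// (internal_temp v).1. Qed.

(** The internal heat capacity at the local internal temperature [th]. *)
Let c v := derive1 (eint g) (th v).
Let c0 v : 0 < c v. Proof. by apply: cv_gt0; exact: (internal_temp v).1. Qed.

(* [kappa] is minus the derivative of [1 / Tint] at [G / F]. *)
Let kappa v := ((th v) ^+ 2 * c v)^-1.
Let kappa0 v : 0 < kappa v.
Proof.
by rewrite invr_gt0 mulr_gt0// exprn_gt0// (internal_temp v).1.
Qed.

(** The partial derivative of [y = G / F], as produced by [is_derive_div]. *)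
Let q i v := (D i G v - y v * D i F v) / F v.

Lemma is_derive_internal_temp i v :
  is_derive v (basis R i) th ((c v)^-1 * q i v).
Proof.
have sF := smooth_is_derive v (basis R i) (vreg_smoothF FGreg).
have sG := smooth_is_derive v (basis R i) (vreg_smoothG FGreg).
have Dy : is_derive v (basis R i) y (q i v) := is_derive_div (F_neq0 v) sG sF.
have [t0 Et] := internal_temp v.
have DT : is_derive (y v) 1 (Tint g) (c v)^-1.
  by rewrite -Et; exact: is_derive_Tint.
exact: (is_derive_comp_scalar (f := y) DT Dy).
Qed.

Lemma grad_HG i v : grad HG v 0 i = kappa v * q i v / gasR g.
Proof.
rewrite gradE; have -> : HG = fun v => - 1 / (gasR g * th v).
  by apply/funext => w; rewrite /HG dHentGE ?mulN1r//; exact: (vreg_J FGreg).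
have rth : gasR g * th v != 0 by rewrite mulf_neq0// gt_eqF.
have Drth := is_derive_mul (is_derive_cst (gasR g) v (basis R i))
  (is_derive_internal_temp i v).
have DHG := is_derive_div (h := fun w => gasR g * th w) rth
  (is_derive_cst (- 1 : R) v (basis R i)) Drth.
rewrite derive_val /cst /kappa.
have cn : c v != 0 by rewrite gt_eqF.
have rn : gasR g != 0 by rewrite gt_eqF.
have tn := th_neq0 v.
by move: (c v) (gasR g) (th v) (q i v) cn rn tn => ? ? ? ? *; field; apply/and3P.
Qed.

(** Since [sint] has derivative [1 / th] at [y], the terms in [q / th] from [sint y] and [y / th]
    cancel; only the variation of [1 / th] survives, through [kappa]. *)
Lemma grad_HF i v :
  grad HF v 0 i = D i F v / F v - y v * kappa v * q i v / gasR g.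
Proof.
rewrite gradE.
have -> : HF = fun v =>
    ln (F v) + 1 - (sint g (y v) - y v / th v) / gasR g.
  by apply/funext => w; rewrite /HF dHentFE//; exact: (vreg_J FGreg).
have sF := smooth_is_derive v (basis R i) (vreg_smoothF FGreg).
have sG := smooth_is_derive v (basis R i) (vreg_smoothG FGreg).
have Dy : is_derive v (basis R i) y (q i v) := is_derive_div (F_neq0 v) sG sF.
have [t0 Et] := internal_temp v.
have Dth := is_derive_internal_temp i v.
have Ds : is_derive (y v) 1 (sint g) (th v)^-1.
  by rewrite -Et; have := sint_derive g t0; rewrite TintK.
have Dsint := is_derive_comp_scalar (f := y) Ds Dy.
have Dln := is_derive_comp_scalar (is_derive1_ln (F0 v)) sF.
have rn : gasR g != 0 by rewrite gt_eqF.
have DHF := is_derive_sub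
  (is_derive_add Dln (is_derive_cst (1 : R) v (basis R i)))
  (is_derive_div (h := fun=> gasR g) rn
     (is_derive_sub Dsint (is_derive_div (h := th) (th_neq0 v) Dy Dth))
     (is_derive_cst (gasR g) v (basis R i))).
rewrite derive_val -/(th v) /kappa /D.
have cn : c v != 0 by rewrite gt_eqF.
have tn := th_neq0 v; have Fn := F_neq0 v.
move: (c v) (gasR g) (th v) (q i v) (y v) (F v) ('D_(basis R i) F v)
  (sint g (y v)) cn rn tn Fn.
by move=> ? ? ? ? ? ? ? ? *; field; apply/and4P.
Qed.

(* Completing the square: the gap between the two sides is
   [(F w + R T dF)^2 / (R T F) + kappa T F q^2]. *)
Lemma dissipation_component (r t a w Fi Gi y0 k q0 : R) :
  0 < r -> 0 < t -> 0 < a -> 0 < k -> Gi = a * q0 + y0 * Fi ->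
  - ((Fi / a - y0 * k * q0 / r) * (a * w + r * t * Fi))
  - k * q0 / r * (y0 * a * w + r * t * Gi)
  <= (r * t)^-1 * (w * w * a + r * t * (w * Fi)).
Proof.
move=> r_gt0 t_gt0 a_gt0 k_gt0 ->; rewrite -subr_ge0.
have -> : (r * t)^-1 * (w * w * a + r * t * (w * Fi)) -
    (- ((Fi / a - y0 * k * q0 / r) * (a * w + r * t * Fi)) -
      k * q0 / r * (y0 * a * w + r * t * (a * q0 + y0 * Fi))) =
    (a * w + r * t * Fi) ^+ 2 / (r * t * a) + k * t * a * q0 ^+ 2.
  by field; rewrite !gt_eqF.
apply: addr_ge0; last by rewrite mulr_ge0 ?sqr_ge0// ltW// !mulr_gt0.
by rewrite divr_ge0 ?sqr_ge0// ltW// !mulr_gt0.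
Qed.

(** The gap between the sides is a positive multiple of [(T - th) * (eint T - eint th)], nonnegative
    because [eint] is increasing. *)
Lemma relaxation_le v :
  2 * (HG v * (eint g T * F v - G v))
  <= - (2 / (gasR g * T)) * (eint g T * F v - G v).
Proof.
have [t0 Et] := internal_temp v.
have GE : G v = eint g (th v) * F v by rewrite Et /y divfK.
rewrite /HG dHentGE//; last exact: (vreg_J FGreg).
rewrite -/(y v) -/(th v) GE -subr_ge0.
have -> : - (2 / (gasR g * T)) * (eint g T * F v - eint g (th v) * F v) -
    2 * (- (gasR g * th v)^-1 * (eint g T * F v - eint g (th v) * F v)) =
    2 * F v / (gasR g * T * th v) * ((T - th v) * (eint g T - eint g (th v))).
  have rn : gasR g != 0 by rewrite gt_eqF.
  have tn := th_neq0 v; have Tn : T != 0 by rewrite gt_eqF.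
  move: (eint g T) (eint g (th v)) (gasR g) (th v) (F v) (T) rn tn Tn.
  by move=> ? ? ? ? ? ? *; field; apply/and3P.
apply: mulr_ge0; first by rewrite divr_ge0 ?mulr_ge0// ltW.
have [Tth|/ltW Tth] := leP T (th v).
  by rewrite mulr_le0// subr_le0// eint_le.
by rewrite mulr_ge0// subr_ge0// eint_le.
Qed.

(* An upper bound of the entropy production with zero integral, by the energy
   balance that defines [T]. *)
Let K v := (gasR g * T)^-1 * (sqn (v - u) * F v
    + \sum_i gasR g * T * ((v 0 i - u 0 i) * D i F v))
  - 2 / (gasR g * T) * (eint g T * F v - G v).

Lemma production_le v :
  - dot (grad HF v) (flux g F G F v) - dot (grad HG v) (flux g F G G v)
  + 2 * (HG v * (eint g T * F v - G v)) <= K v.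
Proof.
rewrite /K -[X in _ <= _ - X]opprK opprK -mulNr lerD ?relaxation_le//.
have -> : sqn (v - u) * F v =
    \sum_i (v 0 i - u 0 i) * (v 0 i - u 0 i) * F v.
  rewrite /sqn /dot mulr_suml; apply: eq_bigr => i _.
  by congr (_ * _ * _); rewrite !mxE.
rewrite -big_split mulr_sumr /= /dot -!sumrN -big_split /=.
apply: ler_sum => i _.
(* Substituting [G = y F] in the drift of the second flux gives the shape of
   [dissipation_component]; its hypothesis on [Gi] is the definition of [q] solved for the
   derivative of [G]. *)
rewrite [leLHS](_ : _ =
  - ((D i F v / F v - y v * kappa v * q i v / gasR g)
       * (F v * (v 0 i - u 0 i) + gasR g * T * D i F v))
  - kappa v * q i v / gasR g
       * (y v * F v * (v 0 i - u 0 i) + gasR g * T * D i G v)); last first.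
  congr (- (_ * _) - _ * _); [exact: grad_HF|exact: fluxE|exact: grad_HG|].
  by rewrite fluxE /y divfK.
apply: dissipation_component => //.
by rewrite /q mulrC divfK// subrK.
Qed.

Lemma entropy_production (tau : R) : 0 < tau ->
  flux_ibp g F G (entropy_weights g F G) ->
  vintegrable (fun v => HF v * collF g tau F G v + HG v * collG g tau F G v) ->
  vint (fun v => HF v * collF g tau F G v + HG v * collG g tau F G v) <= 0.
Proof.
move=> tau0 ibpH iS.
have tn : tau != 0 by rewrite gt_eqF.
have [[iF dF vF] _] := ibpH _ (or_introl erefl).
have [_ [iG dG vG]] := ibpH _ (or_intror erefl).
pose rel v := HG v * (eint g T * F v - G v).
have SE : (fun v => HF v * collF g tau F G v + HG v * collG g tau F G v) =
    fun v => tau^-1 * (HF v * div3 (flux g F G F) v) +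
      (tau^-1 * (HG v * div3 (flux g F G G) v) + 2 / tau * rel v).
  apply/funext => v; rewrite /collF /collG -/T /rel.
  move: (HF v) (HG v) (div3 _ v) (div3 _ v) (eint g T) (F v) (G v) => *.
  by ring.
(* The relaxation term is the integrable production minus the two integrable divergence terms,
   rescaled by [tau / 2]. *)
have irel : vintegrable rel.
  have := vintegrableZl (tau / 2) (vintegrableB iS
    (vintegrableD (vintegrableZl tau^-1 iF) (vintegrableZl tau^-1 iG))).
  congr vintegrable; apply/funext => v.
  rewrite /collF /collG -/T /rel.
  rewrite -/(HF v) -/(HG v).
  move: (HF v) (HG v) (div3 _ v) (div3 _ v) (eint g T) (F v) (G v) => *.
  by field.
have vS : vint (fun v => HF v * collF g tau F G v + HG v * collG g tau F G v) =
    tau^-1 * vint (fun v => - dot (grad HF v) (flux g F G F v)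
      - dot (grad HG v) (flux g F G G v) + 2 * rel v).
  rewrite SE.
  apply: etrans (vint_comb3 _ _ _ iF iG irel vF vG erefl) _.
  have -> : (fun v => - dot (grad HF v) (flux g F G F v)
      - dot (grad HG v) (flux g F G G v) + 2 * rel v) =
      fun v => - 1 * dot (grad HF v) (flux g F G F v)
      + (- 1 * dot (grad HG v) (flux g F G G v) + 2 * rel v).
    by apply/funext => v; rewrite !mulN1r addrA.
  rewrite (vint_comb3 _ _ _ dF dG irel erefl erefl erefl).
  move: (vint _) (vint _) (vint _) => *.
  by ring.
rewrite vS pmulr_rle0 ?invr_gt0//.
have iw := integrable_flux_work FGreg.
have ie : vintegrable (fun v => eint g T * F v - G v).
  apply: vintegrableB; last exact: (vreg_energyG FGreg).
  by apply: vintegrableZl; exact: (vreg_mass FGreg).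
have iK : vintegrable K by apply: vintegrableB; exact: vintegrableZl.
have -> : 0 = vint K.
  rewrite /K vintB; [|exact: vintegrableZl|exact: vintegrableZl].
  rewrite (vintZl _ iw) (vintZl _ ie) (int_flux_work FGreg) vintB; last 2 first.
  - by apply: vintegrableZl; exact: (vreg_mass FGreg).
  - exact: (vreg_energyG FGreg).
  rewrite (vintZl _ (vreg_mass FGreg)) -/T -/(rho F).
  by move: (eint g T) (rho F) (vint G) => *; ring.
apply: le_vint => //; last exact: production_le.
have := vintegrableD (vintegrableZl (- 1) dF)
  (vintegrableD (vintegrableZl (- 1) dG) (vintegrableZl 2 irel)).
by congr vintegrable; apply/funext => v; rewrite !mulN1r addrA.
Qed.

End EntropyProduction.

(** * Derivatives in time, one-sided at [t = 0], and in space *)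

Section TimeDerivative.
Context {R : realType}.
Implicit Types (f ft : R -> R) (t l : R).

(** Small positive increments are always admissible, even at [t = 0], so limits of difference
    quotients are unique. *)
Lemma dt_quot_proper t : 0 <= t ->
  ProperFilter (within [set h : R | 0 <= t + h] (0 : R)^').
Proof.
move=> t0; apply: Build_ProperFilter => n0.
have /nbhs_ballP[e /= e0 He] : nbhs (0 : R) [set h | h != 0 -> ~ 0 <= t + h].
  exact: n0.
apply: (He (e / 2)).
- rewrite /ball /= sub0r normrN gtr0_norm ?divr_gt0//.
  by rewrite ltr_pdivrMr// ltr_pMr// ltr1n.
- by rewrite gt_eqF// divr_gt0.
- by rewrite addr_ge0// ltW// divr_gt0.
Qed.

Lemma is_dtE f t l : 0 <= t -> is_dt f t l -> dt f t = l.
Proof.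
move=> t0 fl; have pf := dt_quot_proper t0.
exact: (cvg_lim _ fl).
Qed.

(** On admissible increments the quotients of [f] and [ft] agree, and the two-sided limit for [ft]
    persists on the smaller filter. *)
Lemma dt_extension f ft t l : 0 <= t -> (forall s, 0 <= s -> f s = ft s) ->
  is_derive t 1 ft l -> dt f t = l.
Proof.
move=> t0 fE [dft Dft]; apply: is_dtE => //.
rewrite -Dft /is_dt /dt_quot.
have : (fun h => h^-1 * (ft (t + h) - ft t)) @ 0^' --> 'D_1 ft t.
  have -> : (fun h => h^-1 * (ft (t + h) - ft t)) =
      (fun h => h^-1 *: ((ft \o shift t) (h *: 1) - ft t)).
    by apply/funext => h /=; rewrite [h *: 1]mulr1 [t + h]addrC.
  exact: dft.
move=> ftl; apply: cvg_trans (cvg_within_filter [set h | 0 <= t + h] ftl).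
apply: near_eq_cvg; rewrite near_withinE; near=> h => th.
by rewrite !fE.
Unshelve. all: by end_near. Qed.

Context (F : R -> vec R -> vec R -> R).
Context (sF : smooth_txv F).

Lemma smooth_txv_time t x v : 0 <= t -> exists ft : R -> R,
  (forall s, 0 <= s -> F s x v = ft s) /\
  is_derive t 1 ft (dt (fun s => F s x v) t).
Proof.
move=> t0; have [Ft sFt FE] := sF.
have FtE s : 0 <= s -> F s x v = Ft (s, x, v) by exact: FE.
exists (fun s => Ft (s, x, v)); split=> //.
(* The line [s *: d + p] is [(s, x, v)], so the time derivative is a directional derivative of the
   smooth extension. *)
pose d : R * vec R * vec R := (1, 0, 0).
pose p : R * vec R * vec R := (0, x, v).
have D k : is_derive (k *: d + p) d Ft _ := smooth_is_derive _ _ sFt.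
have E : (fun s : R => Ft (s *: d + p)) = fun s => Ft (s, x, v).
  apply/funext => s; congr (Ft (_, _, _)).
  - by rewrite /= [s *: 1]mulr1 addr0.
  - by rewrite /= scaler0 add0r.
  - by rewrite /= scaler0 add0r.
have := (is_derive_line Ft p d t _).1 (D t); rewrite E => Dt.
by rewrite (dt_extension t0 FtE Dt).
Qed.

Lemma smooth_txv_space t x v e : 0 <= t ->
  is_derive x e (fun y => F t y v) ('D_e (fun y => F t y v) x).
Proof.
move=> t0; have [Ft sFt FE] := sF.
have -> : (fun y => F t y v) = fun y => Ft (t, y, v).
  by apply/funext => y; exact: FE.
apply: derivableP.
pose d : R * vec R * vec R := (0, e, 0).
pose p : R * vec R * vec R := (t, x, v).
have D k : is_derive (k *: d + p) d Ft _ := smooth_is_derive _ _ sFt.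
have E : (fun s : R => Ft (s *: d + p)) =
    fun s => Ft (t, s *: e + x, v).
  apply/funext => s; congr (Ft (_, _, _)).
  - by rewrite /= scaler0 add0r.
  - by rewrite /= scaler0 add0r.
have := (is_derive_line Ft p d 0 _).1 (D 0); rewrite E => Dx.
have [+ _] := (is_derive_line (fun y => Ft (t, y, v)) x e 0 _).2 Dx.
by rewrite scale0r add0r.
Qed.

End TimeDerivative.

(** * The local entropy balance along a solution *)

Section EntropyBalance.
Context {R : realType} (g : gas R).
Context (tau : R -> vec R -> R) (F G : R -> vec R -> vec R -> R).
Context (sol : solution g tau F G) (reg : entropy_regular g F G).
Context (t : R) (x : vec R) (t0 : 0 <= t).

Let FGreg (s : R) (y : vec R) (s0 : 0 <= s) := sol_regular sol y s0.
Let HF v := dHentF g (F t x v) (G t x v).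
Let HG v := dHentG g (F t x v) (G t x v).

(** The chain rule is applied to extensions of [F] and [G] across [t = 0]; positivity and membership
    in [Jint] are used only at [t], where they agree with [F] and [G]. *)
Lemma dt_Hdens v : dt (fun s => Hdens g F G s x v) t =
  HF v * dt (fun s => F s x v) t + HG v * dt (fun s => G s x v) t.
Proof.
have reg_tx := FGreg x t0.
have F0 := vreg_posF reg_tx v; have J := vreg_J reg_tx v.
have [ft [Fft Dft]] := smooth_txv_time (sol_smoothF sol) x v t0.
have [gt [Ggt Dgt]] := smooth_txv_time (sol_smoothG sol) x v t0.
rewrite /HF /HG dHentFE// dHentGE// mulNr.
rewrite Fft// in F0; rewrite Fft// Ggt// in J.
have DH := is_derive_Hent F0 J Dft Dgt.
rewrite !(Fft t)// !(Ggt t)//.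
by apply: (dt_extension t0 _ DH) => s s0; rewrite /Hdens Fft// Ggt.
Qed.

Lemma dx_Hdens v i : 'D_(basis R i) (fun y => Hdens g F G t y v) x =
  HF v * 'D_(basis R i) (fun y => F t y v) x
  + HG v * 'D_(basis R i) (fun y => G t y v) x.
Proof.
have reg_tx := FGreg x t0.
have F0 := vreg_posF reg_tx v; have J := vreg_J reg_tx v.
have DF := smooth_txv_space (sol_smoothF sol) x v (basis R i) t0.
have DG := smooth_txv_space (sol_smoothG sol) x v (basis R i) t0.
have DH := is_derive_Hent (f := fun y => F t y v) (h := fun y => G t y v) F0 J DF DG.
by rewrite /HF /HG dHentFE// dHentGE// mulNr /Hdens derive_val.
Qed.

(** By the chain rule the transport of [H] is that of [F] and [G] weighted by the partial
    derivatives of [H], and the model replaces each by its collision term. *)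
Lemma transport_Hdens v : dt (fun s => Hdens g F G s x v) t
  + \sum_i v 0 i * 'D_(basis R i) (fun y => Hdens g F G t y v) x =
  HF v * collF g (tau t x) (F t x) (G t x) v
  + HG v * collG g (tau t x) (F t x) (G t x) v.
Proof.
rewrite -(sol_F sol)// -(sol_G sol)// /transport dt_Hdens /dot.
under eq_bigr do rewrite dx_Hdens.
under [in RHS]eq_bigr do rewrite gradE.
under [X in _ = _ + _ * (_ + X)]eq_bigr do rewrite gradE.
rewrite !big_ord3.
move: (HF v) (HG v) (dt _ _) (dt _ _) ('D_(basis R 0) (fun y => F t y v) x)
  ('D_(basis R 1) (fun y => F t y v) x)
  ('D_(basis R (inord 2)) (fun y => F t y v) x)
  ('D_(basis R 0) (fun y => G t y v) x) ('D_(basis R 1) (fun y => G t y v) x)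
  ('D_(basis R (inord 2)) (fun y => G t y v) x) => *.
by ring.
Qed.

Lemma entropy_balance : dt (fun s => entropy g F G s x) t
  + div3 (entropy_flux g F G t) x =
  vint (fun v => HF v * collF g (tau t x) (F t x) (G t x) v
    + HG v * collG g (tau t x) (F t x) (G t x) v).
Proof.
rewrite (is_dtE t0 (ereg_dt (x := x) reg t0)) /div3.
under eq_bigr => i _.
  have Di := ereg_dx reg x i t0.
  rewrite derive_val.
  over.
rewrite -vint_sum; last by move=> i; exact: (ereg_dxH reg).
rewrite -vintD; [|exact: (ereg_dtH reg)|].
  by congr vint; apply/funext => v; exact: transport_Hdens.
by apply: vintegrable_sum => i; exact: (ereg_dxH reg).
Qed.

(** Integrability is read off the transport side, whose terms are integrable by
    [entropy_regular]. *)
Lemma integrable_entropy_production :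
  vintegrable (fun v => HF v * collF g (tau t x) (F t x) (G t x) v
    + HG v * collG g (tau t x) (F t x) (G t x) v).
Proof.
have -> : (fun v => HF v * collF g (tau t x) (F t x) (G t x) v
    + HG v * collG g (tau t x) (F t x) (G t x) v) =
    fun v => dt (fun s => Hdens g F G s x v) t
      + \sum_i v 0 i * 'D_(basis R i) (fun y => Hdens g F G t y v) x.
  by apply/funext => v; rewrite transport_Hdens.
apply: vintegrableD; first exact: (ereg_dtH reg).
by apply: vintegrable_sum => i; exact: (ereg_dxH reg).
Qed.

Lemma H_theorem : 0 < tau t x ->
  dt (fun s => entropy g F G s x) t + div3 (entropy_flux g F G t) x <= 0.
Proof.
move=> tau0; rewrite entropy_balance.
apply: (entropy_production (FGreg x t0) tau0); first exact: (ereg_flux reg).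
exact: integrable_entropy_production.
Qed.

End EntropyBalance.

Theorem proposition4p1 (R : realType) (g : gas R) :
  (forall (tau : R) (F G : vec R -> R),
     0 < tau -> velocity_regular g F G ->
     [/\ vint (collF g tau F G) = 0,
         forall i : 'I_3, vint (fun v => v 0 i * collF g tau F G v) = 0 &
         vint (fun v => 2^-1 * sqn v * collF g tau F G v + collG g tau F G v)
           = 0])
  /\
  (forall (tau : R -> vec R -> R) (F G : R -> vec R -> vec R -> R),
     (forall (t : R) (x : vec R), 0 <= t -> 0 < tau t x) ->
     solution g tau F G -> entropy_regular g F G ->
     forall (t : R) (x : vec R), 0 <= t ->
       dt (fun s => entropy g F G s x) t + div3 (entropy_flux g F G t) x <= 0)
  /\
  (forall (tau : R) (F G : vec R -> R),
     0 < tau -> velocity_regular g F G ->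
     flux_ibp g F G (maxwellian_weights g F G) ->
     ((forall v, collF g tau F G v = 0) /\ (forall v, collG g tau F G v = 0))
     <->
     ((forall v, F v = maxwellian g F G v) /\
      (forall v, G v = eint g (temp g F G) * maxwellian g F G v))).
Proof.
split; first by move=> tau F G _ FGreg; exact: conservation.
split.
  move=> tau F G tau0 sol reg t x t0.
  by apply: (H_theorem sol reg t0); exact: tau0.
by move=> tau F G tau0 FGreg ibpM; exact: equilibrium.
Qed.
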